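(* Let $q$ be a prime power and let $0<R\le 1$ be a rational number. Let $n,K,N\ge 1$ be sufficiently large integers with $K=RN$, and let $\varepsilon>0$. Let $C_{\rm out}$ be a random linear code over $\mathbb{F}_{q^n}$ generated by a uniformly random $K\times N$ matrix over $\mathbb{F}_{q^n}$. Let $C_{\rm in}^1,\dots,C_{\rm in}^N$ be random linear codes over $\mathbb{F}_q$, where $C_{\rm in}^i$ is generated by a uniformly random $n\times n$ matrix $G_i$ over $\mathbb{F}_q$, and the random choices of $C_{\rm out},G_1,\dots,G_N$ are all independent. Then, with probability at least $1-q^{-\Omega(nN)}$ over these choices, the concatenated code $C^*=C_{\rm out}\circ(C_{\rm in}^1,\dots,C_{\rm in}^N)$ is $\left(1-R-\varepsilon,q^{O(1/\varepsilon^2)}\right)_{led}$-list decodable. Further, with high probability $C^*$ has rate $R$.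
   Context: Code concatenation: for an outer code $C_{\rm out}$ over $\mathbb{F}_{q^n}$ of block length $N$ and inner linear codes $C_{\rm in}^i$ with generator matrices $G_i\in\mathbb{F}_q^{n\times n}$, the concatenated code consists of the words $(u_1G_1,\dots,u_NG_N)\in\mathbb{F}_q^{nN}$ for $(u_1,\dots,u_N)\in C_{\rm out}$, each $u_i\in\mathbb{F}_{q^n}$ viewed as a row vector in $\mathbb{F}_q^n$ via a fixed $\mathbb{F}_q$-linear identification. Erasure list decoding: for $c\in\Sigma^M$ and $y\in(\Sigma\cup\{?\})^M$ ($?$ denotes an erasure), write $c\simeq y$ if $c_i=y_i$ for every $i$ with $y_i\neq ?$; $\mathrm{wt}(y)$ is the number of erased positions of $y$. A code $C\subseteq\Sigma^M$ is $(\rho,L)_{led}$-list decodable if for every $y\in(\Sigma\cup\{?\})^M$ with $\mathrm{wt}(y)\le\rho M$, the number of $c\in C$ with $c\simeq y$ is at most $L$.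
   Formalization: The final claim that C* has rate R with high probability is proved only for R < 1; at R = 1 it is false, since rate 1 needs all N random matrices G_i to be invertible, which has probability at most (1-1/q)^N, tending to 0. *)

(* Defs.v *)
From HB Require Import structures.
From mathcomp Require Import all_boot all_order all_algebra.
From mathcomp Require Import reals exp.
Set Implicit Arguments. Unset Strict Implicit. Unset Printing Implicit Defensive.
Import Order.TTheory GRing.Theory Num.Theory.
Local Open Scope ring_scope.

(* Received words over alphabet S indexed by positions I; None denotes the
   erasure symbol "?". *)
Definition agrees (I S : finType) (c : {ffun I -> S}) (y : {ffun I -> option S}) : bool :=
  [forall i, if y i is Some a then c i == a else true].

Definition nerased (I S : finType) (y : {ffun I -> option S}) : nat :=
  #|[set i | y i == None]|.

Definition led_list_decodable (R : realType) (I S : finType)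
    (C : {set {ffun I -> S}}) (rho Lb : R) : bool :=
  [forall y : {ffun I -> option S},
     ((nerased y)%:R <= rho * (#|I|)%:R) ==>
     ((#|[set c in C | agrees c y]|)%:R <= Lb)].

Definition outer_code (L : finFieldType) (K N : nat) (Gout : 'M[L]_(K, N))
  : {set 'rV[L]_N} := [set m *m Gout | m : 'rV[L]_K].

(* Concatenated code C_out o (C_in^1,...,C_in^N): phi is the fixed
   identification of L = F_{q^n} with row vectors F_q^n; position (i, j)
   of a word is the j-th symbol of the i-th inner block u_i G_i. *)
Definition concat_code (F L : finFieldType) (n K N : nat)
    (phi : L -> 'rV[F]_n) (Gout : 'M[L]_(K, N)) (Gin : {ffun 'I_N -> 'M[F]_n})
  : {set {ffun 'I_N * 'I_n -> F}} :=
  [set [ffun p : 'I_N * 'I_n => (phi (u 0 p.1) *m Gin p.1) 0 p.2]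
     | u : 'rV[L]_N in outer_code Gout].

(* Probability of an event over the independent uniform choice of Gout and
   G_1, ..., G_N (uniform on the product space). *)
Definition prob_choice (R : realType) (F L : finFieldType) (n K N : nat)
    (P : 'M[L]_(K, N) -> {ffun 'I_N -> 'M[F]_n} -> bool) : R :=
  (#|[set w : 'M[L]_(K, N) * {ffun 'I_N -> 'M[F]_n} | P w.1 w.2]|)%:R /
  (#|{: 'M[L]_(K, N) * {ffun 'I_N -> 'M[F]_n}}|)%:R.

Definition linear_identification (F L : finFieldType) (n : nat)
    (iota : {rmorphism F -> L}) (phi : L -> 'rV[F]_n) : Prop :=
  [/\ bijective phi, {morph phi : x y / x + y} &
      forall (a : F) (x : L), phi (iota a * x) = a *: phi x].

(* Main.v *)
Require Import Defs.
From HB Require Import structures.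
From mathcomp Require Import all_boot all_order all_algebra.
From mathcomp Require Import mxabelem reals exp.
From mathcomp Require Import zify ring lra.
Set Implicit Arguments. Unset Strict Implicit. Unset Printing Implicit Defensive.
Import Order.TTheory GRing.Theory Num.Theory.
Local Open Scope ring_scope.

(** Let q = |F| and |L| = q^n. The code is F-linear, so a long list yields a set
    T of unerased positions, of size at least (R + eps) n N, and J = mu D
    messages, independent over F, whose encodings all vanish on T. Write them
    as the rows of a matrix M over L, of rank d. In block i the J outer symbols
    form a J x n matrix over F; let W_i ([kers]) be its left kernel and e_i
    ([erank]) the L-rank of the combinations W_i M. For prescribed W_1, ..., W_N
    the probability that they occur and that M vanishes on T is at most
    q^-(sum_i n e_i + |T_i| (J - \rank W_i)), and J - \rank W_i >= d - e_i.
    If d >= D ~ 2/eps this already beats the union bound over T and M. Otherwise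
    d is small compared with J, and M is replaced by combinations P M that
    maximise \rank P - mu \rank_L (P M), which improves the last bound to
    J - \rank W_i >= mu (d - e_i) ([steep]), with mu ~ 5/eps. Then either
    sum_i e_i >= (R + eps/2) d N, an event of the outer code alone which needs
    no union over T, or the term in mu beats the 2^(nN) choices of T. *)

Lemma card_field_ge2 (F : finFieldType) : (2 <= #|F|)%N.
Proof. by apply/card_gt1P; exists 0, 1; rewrite // eq_sym oner_neq0. Qed.

Lemma card_pairs_leq (A B : finType) (P : A -> B -> bool) (S : {set A}) (X y : nat) :
  (forall a b, P a b -> a \in S) ->
  (forall a, a \in S -> #|[set b | P a b]| * y <= X)%N ->
  (#|[set w : A * B | P w.1 w.2]| * y <= #|S| * X)%N.
Proof.
move=> PS PX.
have -> : #|[set w : A * B | P w.1 w.2]| = (\sum_(a in S) #|[set b | P a b]|)%N.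
  rewrite -sum1_card.
  rewrite (eq_bigr (fun a => \sum_(b | P a b) 1)%N); last first.
    by move=> a _; rewrite -sum1_card; apply: eq_bigl => b; rewrite inE.
  rewrite pair_big_dep /=; apply: eq_bigl => -[a b] /=; rewrite inE /=.
  by apply/idP/andP => [Pab|[]//]; split=> //; apply: PS Pab.
rewrite big_distrl -sum_nat_const /=; exact: leq_sum.
Qed.

Lemma card_ffun_sets (I S : finType) (B : I -> {set S}) :
  #|[set f : {ffun I -> S} | [forall i, f i \in B i]]| = (\prod_i #|B i|)%N.
Proof.
rewrite -(@eq_card _ (family B)); first by rewrite card_family foldrE big_image.
by move=> f; rewrite inE; apply/familyP/forallP.
Qed.

Lemma card_mx_cols (S : finType) (m p : nat) (B : 'I_p -> {set 'cV[S]_m}) :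
  (#|[set G : 'M[S]_(m, p) | [forall j, col j G \in B j]]| <= \prod_j #|B j|)%N.
Proof.
rewrite -card_ffun_sets.
rewrite -(@card_imset _ _ (fun G : 'M[S]_(m, p) => [ffun j => col j G])).
  apply/subset_leq_card/subsetP => f /imsetP[G]; rewrite inE => /forallP GB ->.
  by rewrite inE; apply/forallP => j; rewrite ffunE.
move=> G H /ffunP eqGH; apply/matrixP => i j.
by have /colP/(_ i) := eqGH j; rewrite !ffunE !mxE.
Qed.

Lemma card_colker (F : finFieldType) (m p : nat) (A : 'M[F]_(m, p)) :
  (#|[set g : 'cV[F]_p | (A *m g == 0)%R]| * #|F| ^ \rank A <= #|F| ^ p)%N.
Proof.
have -> : #|[set g : 'cV[F]_p | A *m g == 0]| = (#|F| ^ (p - \rank A))%N.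
  rewrite -mxrank_tr -mxrank_ker -card_rowg.
  rewrite -(card_imset _ (@trmx_inj F p 1)); apply: eq_card => v.
  rewrite mem_rowg sub_kermx; apply/imsetP/eqP => [[g + ->]|vA].
    by rewrite inE => /eqP Ag; rewrite -trmx_mul Ag trmx0.
  by exists v^T; rewrite ?trmxK // inE -[A]trmxK -trmx_mul vA trmx0.
by rewrite -expnD subnK // rank_leq_col.
Qed.

Lemma card_mx_rank_leq (F : finFieldType) (m p d : nat) :
  (#|[set M : 'M[F]_(m, p) | \rank M == d]| <= #|F| ^ (m * d + d * p))%N.
Proof.
rewrite expnD -!card_mx -card_prod.
rewrite -cardsT; apply: leq_trans (leq_imset_card (fun BD => BD.1 *m BD.2) _).
apply/subset_leq_card/subsetP => M; rewrite inE => /eqP <-.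
apply/imsetP; exists (col_base M, row_base M); rewrite ?inE //=.
by rewrite mulmx_base.
Qed.

Lemma exists_independent_rows (F L : finFieldType) (iota : {rmorphism F -> L})
    (K J : nat) (V : {set 'rV[L]_K}) :
  (#|F| ^ J <= #|V|)%N ->
  exists M : 'M[L]_(J, K), (forall k, row k M \in V) /\
    (forall w : 'rV[F]_J, map_mx iota w *m M = 0 -> w = 0).
Proof.
elim: J => [_|J IHJ VJ].
  exists 0; split=> [[]//|w _]; exact: thinmx0.
have ltJ : (#|F| ^ J < #|V|)%N by apply: leq_trans VJ; rewrite ltn_exp2l ?card_field_ge2.
have [M [MV Mfree]] := IHJ (ltnW ltJ).
have [v vV vM] : exists2 v, v \in V & v \notin [set map_mx iota w *m M | w : 'rV[F]_J].
  apply/subsetPn; apply: contraTN ltJ => /subset_leq_card le_V.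
  rewrite -leqNgt (leq_trans le_V) // (leq_trans (leq_imset_card _ _)) //.
  by rewrite card_mx mul1n.
rewrite -[J.+1]/(1 + J)%N; exists (col_mx v M); split=> [k|w].
  have [i ->|i ->] := split_ordP k.
    by rewrite rowKu ord1 row_id.
  by rewrite rowKd MV.
rewrite -[w](@hsubmxK _ 1 1 J); set a := lsubmx _; set b := rsubmx _.
rewrite map_row_mx mul_row_col => ab0.
have a0 : a = 0.
  apply: contraNeq vM => a_neq0; rewrite [a]mx11_scalar in ab0 a_neq0.
  set a1 := a 0 0 in ab0 a_neq0.
  have {}a_neq0 : a1 != 0.
    by apply: contraNneq a_neq0 => ->; rewrite raddf0.
  apply/imsetP; exists (- a1^-1 *: b) => //.
  move: ab0; rewrite map_scalar_mx mul_scalar_mx => /eqP.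
  rewrite addr_eq0 => /eqP ab0.
  rewrite map_mxZ -scalemxAl rmorphN fmorphV scaleNr -scalerN -ab0 scalerA.
  by rewrite mulVf ?scale1r // fmorph_eq0.
move: ab0; rewrite a0 raddf0 mul0mx add0r => /Mfree ->.
by rewrite row_mx0.
Qed.

Section KernelCounting.

Variables (F L : finFieldType) (n : nat).
Variables (iota : {rmorphism F -> L}) (phi : L -> 'rV[F]_n).
Hypothesis phiP : linear_identification iota phi.

Local Notation q := #|F|.

Lemma card_extension : #|L| = (q ^ n)%N.
Proof. by case: phiP => /bij_eq_card -> _ _; rewrite card_mx mul1n. Qed.

Lemma identification0 : phi 0 = 0.
Proof. by case: phiP => _ _ phiZ; rewrite -(mulr0 (iota 0)) phiZ scale0r. Qed.

Definition blk J K (M : 'M[L]_(J, K)) (g : 'cV[L]_K) : 'M[F]_(J, n) :=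
  \matrix_(k, j) phi ((M *m g) k 0) 0 j.

Lemma blk_mull p J K (W : 'M[F]_(p, J)) (M : 'M[L]_(J, K)) g :
  blk (map_mx iota W *m M) g = W *m blk M g.
Proof.
case: phiP => _ phiD phiZ; apply/matrixP => a j.
rewrite [LHS]mxE [RHS]mxE -mulmxA [X in phi X]mxE.
rewrite (big_morph phi phiD identification0) summxE; apply: eq_bigr => k _.
by rewrite [map_mx _ _ _ _]mxE phiZ [LHS]mxE [blk _ _ _ _]mxE.
Qed.

Lemma blk_eq0 J K (M : 'M[L]_(J, K)) g : (blk M g == 0) = (M *m g == 0).
Proof.
case: phiP => /bij_inj phi_inj _ _.
apply/eqP/eqP => [/matrixP B0|/matrixP M0]; apply/matrixP => k j.
  rewrite ord1 [RHS]mxE; apply: phi_inj; rewrite identification0.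
  by apply/rowP => j'; have := B0 k j'; rewrite [LHS]mxE => ->; rewrite !mxE.
by rewrite [LHS]mxE M0 mxE identification0 !mxE.
Qed.

Definition kers J K N (M : 'M[L]_(J, K)) (Gout : 'M[L]_(K, N))
  : {ffun 'I_N -> 'M[F]_J} := [ffun i => kermx (blk M (col i Gout))].

Definition vanishes J K N (M : 'M[L]_(J, K)) (T : {set 'I_N * 'I_n})
    (Gout : 'M[L]_(K, N)) (Gin : {ffun 'I_N -> 'M[F]_n}) : bool :=
  [forall p : 'I_N * 'I_n, (p \in T) ==>
     (blk M (col p.1 Gout) *m col p.2 (Gin p.1) == 0)].

Definition erank J K (M : 'M[L]_(J, K)) (W : 'M[F]_J) : nat :=
  \rank (map_mx iota W *m M).

Definition steep (mu : nat) J K (M : 'M[L]_(J, K)) (W : 'M[F]_J) : bool :=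
  (mu * (\rank M - erank M W) <= J - \rank W)%N.

Definition kers_exponent J K N (M : 'M[L]_(J, K)) (W : {ffun 'I_N -> 'M[F]_J})
    (T : {set 'I_N * 'I_n}) : nat :=
  (\sum_i (n * erank M (W i) + #|[set j | (i, j) \in T]| * (J - \rank (W i))))%N.

Lemma card_kers_eq J K N (M : 'M[L]_(J, K)) (W : {ffun 'I_N -> 'M[F]_J}) :
  (#|[set Gout | kers M Gout == W]| * q ^ (\sum_i n * erank M (W i))
     <= #|{: 'M[L]_(K, N)}|)%N.
Proof.
set S := [set _ | _].
pose B i := [set g : 'cV[L]_K | map_mx iota (W i) *m M *m g == 0].
have leS : (#|S| <= \prod_i #|B i|)%N.
  apply: leq_trans (card_mx_cols B); apply/subset_leq_card/subsetP => G.
  rewrite !inE => /eqP/ffunP kW; apply/forallP => i.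
  by rewrite inE -blk_eq0 blk_mull -kW ffunE mulmx_ker.
apply: leq_trans (leq_mul leS (leqnn _)) _.
rewrite expn_sum -big_split /= card_mx expnM.
rewrite -[X in (_ <= _ ^ X)%N]card_ord -prod_nat_const.
apply: leq_prod => i _; rewrite expnM -card_extension.
by have := card_colker (map_mx iota (W i) *m M); rewrite card_extension.
Qed.

Lemma card_vanishing J K N (M : 'M[L]_(J, K)) (T : {set 'I_N * 'I_n}) Gout :
  (#|[set Gin | vanishes M T Gout Gin]| *
     q ^ (\sum_i #|[set j | (i, j) \in T]| * \rank (blk M (col i Gout)))
     <= #|{: {ffun 'I_N -> 'M[F]_n}}|)%N.
Proof.
pose U i := blk M (col i Gout).
pose Z i := [set G : 'M[F]_n | [forall j, ((i, j) \in T) ==> (U i *m col j G == 0)]].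
have -> : #|[set Gin | vanishes M T Gout Gin]| = (\prod_i #|Z i|)%N.
  rewrite -card_ffun_sets; apply: eq_card => G; rewrite !inE.
  apply/forallP/forallP => [v i|v [i j]].
    by rewrite inE; apply/forallP => j; have := v (i, j).
  by have := v i; rewrite inE => /forallP/(_ j).
rewrite expn_sum -big_split card_ffun /= -prod_nat_const.
apply: leq_prod => i _.
pose B j := if (i, j) \in T then [set g : 'cV[F]_n | U i *m g == 0] else setT.
have leZ : (#|Z i| <= \prod_j #|B j|)%N.
  apply: leq_trans (card_mx_cols B); apply/subset_leq_card/subsetP => G.
  rewrite !inE => /forallP v; apply/forallP => j; have := v j.
  by rewrite /B; case: ifP; rewrite !inE.
apply: leq_trans (leq_mul leZ (leqnn _)) _.
rewrite -[#|[set j | (i, j) \in T]|]sum1_card big_distrl /= expn_sum.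
rewrite [X in (_ * X)%N]big_mkcond -big_split /= card_mx [leqRHS]expnM.
rewrite -[X in (_ <= _ ^ X)%N]card_ord -prod_nat_const.
apply: leq_prod => j _; rewrite inE mul1n /B; case: ifP => _.
  exact: card_colker.
by rewrite muln1 cardsT card_mx muln1.
Qed.

Lemma card_fixed_kers J K N (M : 'M[L]_(J, K)) (W : {ffun 'I_N -> 'M[F]_J}) T :
  (#|[set w : 'M[L]_(K, N) * {ffun 'I_N -> 'M[F]_n} |
      (kers M w.1 == W) && vanishes M T w.1 w.2]| * q ^ kers_exponent M W T
     <= #|{: 'M[L]_(K, N) * {ffun 'I_N -> 'M[F]_n}}|)%N.
Proof.
rewrite /kers_exponent big_split /= expnD mulnA mulnAC card_prod.
apply: leq_trans (leq_mul (card_kers_eq M W) (leqnn _)); rewrite [leqRHS]mulnAC.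
rewrite leq_mul2r; apply/orP; right.
apply: (@card_pairs_leq _ _ (fun Gout Gin => (kers M Gout == W) && vanishes M T Gout Gin)).
  by move=> a b /andP[+ _]; rewrite inE.
move=> Gout; rewrite inE => /eqP kW.
rewrite -kW eqxx /=; apply: leq_trans (card_vanishing M T Gout).
rewrite leq_mul2l; apply/orP; right; apply: eq_leq; congr (_ ^ _)%N.
apply: eq_bigr => i _; rewrite ffunE mxrank_ker subKn //; exact: rank_leq_row.
Qed.

Lemma steep1 J K (M : 'M[L]_(J, K)) (W : 'M[F]_J) : steep 1 M W.
Proof.
rewrite /steep mul1n.
have := mxrank_mul_min (map_mx iota W) M; rewrite mxrank_map /erank.
move: (\rank (_ *m _)) (\rank M) (rank_leq_row W) => e d; lia.
Qed.

(* The row combinations P with \rank P - mu \rank_L (P M) maximal play the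
   role of the first step of a Harder-Narasimhan filtration: passing from
   P to any W P cannot increase this quantity. *)
Lemma exists_steep_combination J K (M : 'M[L]_(J, K)) (mu : nat) :
    (forall w : 'rV[F]_J, map_mx iota w *m M = 0 -> w = 0) ->
    (mu * \rank M < J)%N ->
  exists P : 'M[F]_J, let M' := map_mx iota P *m M in
    (0 < \rank M')%N /\ forall g : 'cV[L]_K, steep mu M' (kermx (blk M' g)).
Proof.
move=> Mfree muJ.
pose f (P : 'M[F]_J) := (\rank P + mu * (J - erank M P))%N.
have leJ P : (erank M P <= J)%N by apply: rank_leq_row.
have [P _ Pmax] := @arg_maxnP _ (1%:M : 'M[F]_J) xpredT f isT.
have f1 := Pmax 1%:M isT.
exists P => M'; split.
  rewrite lt0n -/(erank M P); apply/negP => /eqP eP0; move: f1.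
  have P0 : P = 0.
    apply/row_matrixP => k; rewrite row0; apply: Mfree.
    rewrite map_row -row_mul; move/eqP: eP0; rewrite mxrank_eq0 => /eqP ->.
    by rewrite row0.
  rewrite /f P0 mxrank0 mxrank1 {2}/erank map_mx1 mul1mx.
  have := leJ 0; have := rank_leq_row M; nia.
move=> g; rewrite -/M'; set W := kermx _; rewrite /steep.
have := Pmax (W *m P) isT; rewrite /f.
have -> : erank M (W *m P) = erank M' W.
  by rewrite /erank /M' map_mxM mulmxA.
have kPW : (kermx P <= W)%MS.
  rewrite sub_kermx -blk_mull /M' mulmxA -map_mxM mulmx_ker raddf0 mul0mx.
  by rewrite blk_eq0 mul0mx.
have := mxrank_mul_ker W P.
rewrite (capmx_idPr kPW) mxrank_ker.
have := rank_leq_row P; have := rank_leq_row W.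
rewrite -[\rank M']/(erank M P).
have := leJ P; have : (erank M' W <= J)%N by apply: rank_leq_row.
move: (erank M' W) (erank M P) (\rank W) (\rank P) (\rank (W *m P)) => a b c d e.
nia.
Qed.

End KernelCounting.

Section Encoding.

Variables (F L : finFieldType) (n : nat).
Variables (iota : {rmorphism F -> L}) (phi : L -> 'rV[F]_n).
Hypothesis phiP : linear_identification iota phi.

Local Notation q := #|F|.

Lemma card_block_sum N (T : {set 'I_N * 'I_n}) :
  (\sum_i #|[set j | (i, j) \in T]|)%N = #|T|.
Proof.
rewrite -sum1_card (eq_bigr (fun i => \sum_(j | (i, j) \in T) 1)%N); last first.
  by move=> i _; rewrite -sum1_card; apply: eq_bigl => j; rewrite inE.
by rewrite pair_big_dep /=; apply: eq_bigl => -[i j].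
Qed.

Lemma kers_exponent_ge_rank J K N (M : 'M[L]_(J, K)) (W : {ffun 'I_N -> 'M[F]_J})
    (T : {set 'I_N * 'I_n}) :
  (\rank M * #|T| <= kers_exponent iota M W T)%N.
Proof.
rewrite -card_block_sum big_distrr /=; apply: leq_sum => i _.
have := steep1 iota M (W i); rewrite /steep mul1n.
have : (#|[set j | (i, j) \in T]| <= n)%N.
  by rewrite -[X in (_ <= X)%N]card_ord; apply: max_card.
move: (#|_|) (erank _ _ _) (\rank M) (\rank (W i)) => t e d w; nia.
Qed.

Lemma kers_exponent_ge_steep (mu : nat) J K N (M : 'M[L]_(J, K))
    (W : {ffun 'I_N -> 'M[F]_J})
    (T : {set 'I_N * 'I_n}) :
    [forall i, steep iota mu M (W i)] ->
  (mu * (\rank M * #|T|) <=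
     kers_exponent iota M W T + mu * (n * \sum_i erank iota M (W i)))%N.
Proof.
move=> /forallP Wsteep; rewrite -card_block_sum !big_distrr -big_split /=.
apply: leq_sum => i _; have := Wsteep i; rewrite /steep.
have : (#|[set j | (i, j) \in T]| <= n)%N.
  by rewrite -[X in (_ <= X)%N]card_ord; apply: max_card.
move: (#|_|) (erank _ _ _) (\rank M) (J - \rank (W i))%N => t e d w.
move=> le_t le_w.
have h1 : (mu * (d * t) <= t * (mu * (d - e)) + mu * (t * e))%N.
  have : (d <= d - e + e)%N by lia.
  by move: (d - e)%N => f /(leq_mul (leqnn (mu * t))); rewrite mulnDr; lia.
have h2 : (t * (mu * (d - e)) <= t * w)%N by rewrite leq_mul2l le_w orbT.
have h3 : (mu * (t * e) <= mu * (n * e))%N by rewrite leq_mul2l leq_mul2r le_t !orbT.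
lia.
Qed.

Lemma vanishes_mull p J K N (W : 'M[F]_(p, J)) (M : 'M[L]_(J, K)) (T : {set 'I_N * 'I_n})
    Gout Gin :
  vanishes phi M T Gout Gin -> vanishes phi (map_mx iota W *m M) T Gout Gin.
Proof.
move=> /forallP MT; apply/forallP => x; apply/implyP => xT.
by rewrite (blk_mull phiP) -mulmxA (eqP (implyP (MT x) xT)) mulmx0.
Qed.

Lemma vanishes_rows J K N (M : 'M[L]_(J, K)) (T : {set 'I_N * 'I_n}) Gout Gin :
  (forall k, vanishes phi (row k M) T Gout Gin) -> vanishes phi M T Gout Gin.
Proof.
move=> MT; apply/forallP => x; apply/implyP => xT; apply/eqP/row_matrixP => k.
have /forallP/(_ x)/implyP/(_ xT)/eqP := MT k.
rewrite row0 row_mul => <-; congr (_ *m _).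
apply/rowP => j; rewrite !mxE; congr (phi _ 0 j).
by apply: eq_bigr => l _; rewrite !mxE.
Qed.

Definition encode K N (Gout : 'M[L]_(K, N)) (Gin : {ffun 'I_N -> 'M[F]_n})
    (m : 'rV[L]_K) : {ffun 'I_N * 'I_n -> F} :=
  [ffun p => (phi ((m *m Gout) 0 p.1) *m Gin p.1) 0 p.2].

Lemma concat_codeE K N (Gout : 'M[L]_(K, N)) Gin :
  concat_code phi Gout Gin = [set encode Gout Gin m | m : 'rV[L]_K].
Proof.
apply/setP => c; apply/imsetP/imsetP => [[u /imsetP[m _ ->] ->]|[m _ ->]].
  by exists m.
by exists (m *m Gout) => //; apply: imset_f.
Qed.

Lemma encodeD K N (Gout : 'M[L]_(K, N)) Gin m m' p :
  encode Gout Gin (m + m') p = encode Gout Gin m p + encode Gout Gin m' p.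
Proof.
by case: phiP => _ phiD _; rewrite !ffunE mulmxDl [X in phi X]mxE phiD mulmxDl mxE.
Qed.

Lemma encodeB K N (Gout : 'M[L]_(K, N)) Gin m m' p :
  encode Gout Gin (m - m') p = encode Gout Gin m p - encode Gout Gin m' p.
Proof. by apply/eqP; rewrite eq_sym subr_eq -encodeD subrK. Qed.

Lemma vanishes_encodeP K N (m : 'rV[L]_K) (T : {set 'I_N * 'I_n}) Gout Gin :
  reflect (forall p, p \in T -> encode Gout Gin m p = 0) (vanishes phi m T Gout Gin).
Proof.
have blkE (p : 'I_N * 'I_n) :
    blk phi m (col p.1 Gout) *m col p.2 (Gin p.1) = (encode Gout Gin m p)%:M.
  rewrite [LHS]mx11_scalar ffunE; congr (_%:M).
  rewrite !mxE; apply: eq_bigr => k _; rewrite !mxE; congr (phi _ 0 k * _).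
  by apply: eq_bigr => l _; rewrite mxE.
apply: (iffP forallP) => mT p; first move=> pT.
  have /implyP/(_ pT)/eqP := mT p; rewrite blkE => /matrixP/(_ 0 0).
  by rewrite !mxE eqxx.
by apply/implyP => /mT e0; rewrite blkE e0 raddf0.
Qed.

Lemma card_agreeing_leq K N (Gout : 'M[L]_(K, N)) Gin y :
  (#|[set c in concat_code phi Gout Gin | agrees c y]| <=
   #|[set m : 'rV[L]_K | vanishes phi m [set p | y p != None] Gout Gin]|)%N.
Proof.
set A := [set c in _ | _].
have [->|[c0]] := set_0Vmem A; first by rewrite cards0.
rewrite inE concat_codeE => /andP[/imsetP[m0 _ ->] /forallP y0].
set V := [set m : 'rV[L]_K | _].
apply: leq_trans (leq_imset_card (fun m => encode Gout Gin (m + m0)) V).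
apply/subset_leq_card/subsetP => c; rewrite inE concat_codeE.
move=> /andP[/imsetP[m _ ->] /forallP ym].
apply/imsetP; exists (m - m0); last by rewrite subrK.
rewrite inE; apply/vanishes_encodeP => p; rewrite inE => yp.
apply/eqP; rewrite encodeB subr_eq0; move: (ym p) (y0 p).
by case: (y p) yp => // a _ /eqP -> /eqP ->.
Qed.

Lemma exists_rows_vanishing (mu D K N : nat) (T : {set 'I_N * 'I_n})
    (Gout : 'M[L]_(K, N)) Gin :
    (0 < mu)%N -> (0 < D)%N ->
    (q ^ (mu * D) <= #|[set m : 'rV[L]_K | vanishes phi m T Gout Gin]|)%N ->
  exists M : 'M[L]_(mu * D, K), [/\ vanishes phi M T Gout Gin, (0 < \rank M)%N &
    (D <= \rank M)%N || [forall i, steep iota mu M (kers phi M Gout i)]].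
Proof.
move=> mu_gt0 D_gt0 /(exists_independent_rows iota)[M [MV Mfree]].
have MT : vanishes phi M T Gout Gin.
  by apply: vanishes_rows => k; have := MV k; rewrite inE.
case: (leqP D (\rank M)) => [leD|ltD].
  by exists M; rewrite leD (leq_trans D_gt0 leD).
have ltJ : (mu * \rank M < mu * D)%N by rewrite ltn_pmul2l.
have [P [P_gt0 Psteep]] := exists_steep_combination phiP Mfree ltJ.
exists (map_mx iota P *m M); split=> //; first exact: vanishes_mull.
by apply/orP; right; apply/forallP => i; rewrite ffunE.
Qed.

End Encoding.

Section UnionBound.

Variables (F L : finFieldType) (n : nat).
Variables (iota : {rmorphism F -> L}) (phi : L -> 'rV[F]_n).
Hypothesis phiP : linear_identification iota phi.

Local Notation q := #|F|.
Variable R : realType.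
Local Notation qR := (q%:R : R).

Lemma card_field_ge1R : 1 <= qR.
Proof. by rewrite ler1n ltnW // card_field_ge2. Qed.

Lemma card_field_gt0R : 0 < qR.
Proof. exact: lt_le_trans ltr01 card_field_ge1R. Qed.

Lemma powR_cardD (x y : R) : qR `^ (x + y) = qR `^ x * qR `^ y.
Proof. by rewrite powRD // (gt_eqF card_field_gt0R) implybT. Qed.

Lemma powR_card_nat (e : nat) : qR `^ e%:R = (q ^ e)%:R.
Proof. by rewrite powR_mulrn ?natrX // ltW // card_field_gt0R. Qed.

Lemma natr_le_powRN (c e t : nat) (x : R) :
  (c * q ^ e <= t)%N -> x <= e%:R -> c%:R <= t%:R * qR `^ (- x).
Proof.
move=> cet xe; rewrite powRN ler_pdivlMr; last first.
  by apply: powR_gt0; apply: card_field_gt0R.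
apply: le_trans (_ : c%:R * qR `^ e%:R <= _).
  by rewrite ler_wpM2l // ler_powR // card_field_ge1R.
by rewrite powR_card_nat -natrM ler_nat.
Qed.

Lemma card_exists_leq (A B : finType) (P : pred A) (Q : A -> pred B) (x : R) :
    (forall a, P a -> #|[set b | Q a b]|%:R <= x) ->
  #|[set b | [exists a, P a && Q a b]]|%:R <= #|P|%:R * x.
Proof.
move=> Qx; apply: le_trans (_ : (\sum_(a | P a) #|[set b | Q a b]|)%:R <= _).
  rewrite ler_nat.
  have -> : [set b | [exists a, P a && Q a b]] = \bigcup_(a | P a) [set b | Q a b].
    apply/setP => b; rewrite inE; apply/existsP/bigcupP => [[a /andP[Pa Qab]]|[a Pa]].
      by exists a; rewrite ?inE.
    by rewrite inE => Qab; exists a; rewrite Pa.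
  elim/big_rec2: _ => [|a m S _ leS]; first by rewrite cards0.
  by apply: leq_trans (leq_card_setU _ _) _; rewrite leq_add2l.
rewrite natr_sum mulr_natl -sumr_const; exact: ler_sum.
Qed.

Lemma prob_choice_ge K N (P : 'M[L]_(K, N) -> {ffun 'I_N -> 'M[F]_n} -> bool) (x : R) :
    #|[set w : 'M[L]_(K, N) * {ffun 'I_N -> 'M[F]_n} | ~~ P w.1 w.2]|%:R <=
      #|{: 'M[L]_(K, N) * {ffun 'I_N -> 'M[F]_n}}|%:R * x ->
  1 - x <= prob_choice R P.
Proof.
set t := #|{: _}| => leB.
have t_gt0 : (0 : R) < t%:R.
  by rewrite ltr0n; apply/card_gt0P; exists (0, [ffun=> 0]).
rewrite /prob_choice -/t ler_pdivlMr // mulrBl mul1r lerBlDr mulrC -lerBlDl.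
apply: le_trans leB; rewrite lerBlDl -natrD ler_nat /t.
rewrite -(cardsC [set w : 'M[L]_(K, N) * {ffun 'I_N -> 'M[F]_n} | P w.1 w.2]).
rewrite leq_add2l; apply: subset_leq_card; apply/subsetP => w.
by rewrite !inE.
Qed.

Section FixedDesign.

Variables (mu D : nat) (eps rr : R).
Hypotheses (eps_gt0 : 0 < eps) (eps_le1 : eps <= 1).
Hypothesis rr_le1 : rr <= 1.
Hypotheses (eps_mu : 5 <= eps * mu%:R) (eps_D : 2 <= eps * D%:R).
Variables (J K N : nat).

Definition large (T : {set 'I_N * 'I_n}) : bool :=
  (rr + eps) * (N * n)%:R <= #|T|%:R.

Definition admissible (M : 'M[L]_(J, K)) (W : {ffun 'I_N -> 'M[F]_J}) : bool :=
  (D <= \rank M)%N || [forall i, steep iota mu M (W i)].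

Local Notation total := (#|{: 'M[L]_(K, N) * {ffun 'I_N -> 'M[F]_n}}|%:R : R).

Lemma card_large_vanishing (M : 'M[L]_(J, K)) (W : {ffun 'I_N -> 'M[F]_J}) :
    (0 < \rank M)%N -> admissible M W ->
  #|[set w : 'M[L]_(K, N) * {ffun 'I_N -> 'M[F]_n} | (kers phi M w.1 == W) &&
      [exists T, large T && vanishes phi M T w.1 w.2]]|%:R
    <= total * qR `^ (- ((rr + eps / 2) * (\rank M)%:R * (N * n)%:R)).
Proof.
set d := \rank M => d_gt0 admW.
set x := (rr + eps / 2) * _ * _; set sd := (\sum_i erank iota M (W i))%N.
case: (boolP (~~ (D <= d)%N && ((rr + eps / 2) * d%:R * N%:R <= sd%:R))).
  move=> /andP[_ sd_large].
  (* With the empty set of positions no union over T is needed. *)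
  have := card_fixed_kers phiP M W set0; set c := #|_| => le_c.
  have {}le_c := natr_le_powRN le_c (x := x); apply: le_trans (le_c _).
    rewrite ler_nat; apply/subset_leq_card/subsetP => w; rewrite !inE.
    by move=> /andP[-> _]; apply/forallP => p; rewrite inE.
  rewrite /kers_exponent (eq_bigr (fun i => n * erank iota M (W i))%N); last first.
    move=> i _; rewrite (_ : [set j | _] = set0) ?cards0 ?addn0 //.
    by apply/setP => j; rewrite !inE.
  rewrite -big_distrr -/sd natrM /x natrM.
  have : (0 : R) <= n%:R by [].
  nra.
move=> nW.
have exponent_large T : large T -> x + (N * n)%:R <= (kers_exponent iota M W T)%:R.
  rewrite /large => leT; have m_ge0 : (0 : R) <= (N * n)%:R by [].
  have d_ge1 : (1 : R) <= d%:R by rewrite ler1n.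
  case: (leqP D d) nW => [leD _|ltD /=].
    have : (d * #|T| <= kers_exponent iota M W T)%N := kers_exponent_ge_rank _ _ _ _.
    rewrite -(ler_nat R) natrM; apply: le_trans.
    apply: le_trans (_ : d%:R * ((rr + eps) * (N * n)%:R) <= _); last first.
      by rewrite ler_wpM2l.
    have : (2 : R) <= eps * d%:R.
      by apply: le_trans eps_D _; rewrite ler_wpM2l ?ler_nat // ltW.
    rewrite /x; nra.
  rewrite -ltNge => sd_small.
  have Wsteep : [forall i, steep iota mu M (W i)].
    by move: admW; rewrite /admissible leqNgt ltD.
  have := kers_exponent_ge_steep T Wsteep.
  rewrite -/d -/sd -(ler_nat R) natrD ![(mu * _)%:R]natrM => le_e.
  have le_dT : d%:R * ((rr + eps) * (N * n)%:R) <= (d * #|T|)%:R.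
    by rewrite [leRHS]natrM ler_wpM2l.
  have le_sd : (n * sd)%:R <= x.
    rewrite natrM /x natrM mulrA mulrC ler_wpM2r //; exact: ltW.
  have le_mu : mu%:R * (d%:R * (eps / 2) * (N * n)%:R) <=
      mu%:R * ((d * #|T|)%:R - (n * sd)%:R).
    rewrite ler_wpM2l //; move: le_dT le_sd; rewrite /x; lra.
  have dm_ge : (N * n)%:R <= d%:R * (N * n)%:R :> R by rewrite ler_peMl.
  have mu_dm : 5 * (d%:R * (N * n)%:R) <= eps * mu%:R * (d%:R * (N * n)%:R).
    by rewrite ler_wpM2r // mulr_ge0.
  have x_le : x <= 3 / 2 * (d%:R * (N * n)%:R).
    have : rr + eps / 2 <= 3 / 2 by move: rr_le1 eps_le1; lra.
    by rewrite /x -mulrA => /ler_wpM2r -> //; rewrite mulr_ge0.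
  lra.
pose Q T := [pred w : 'M[L]_(K, N) * {ffun 'I_N -> 'M[F]_n} |
  (kers phi M w.1 == W) && vanishes phi M T w.1 w.2].
apply: le_trans (_ : #|[set w | [exists T, large T && Q T w]]|%:R <= _).
  rewrite ler_nat; apply/subset_leq_card/subsetP => w; rewrite !inE.
  move=> /andP[kW /existsP[T /andP[lT vT]]]; apply/existsP; exists T.
  by rewrite lT /= kW.
apply: le_trans (card_exists_leq (x := total * qR `^ (- (x + (N * n)%:R))) _) _.
  move=> T lT; apply: natr_le_powRN (exponent_large T lT).
  exact: card_fixed_kers.
rewrite mulrCA ler_wpM2l // opprD addrC powR_cardD mulrA.
rewrite ler_piMl ?powR_ge0 // powRN powR_card_nat ler_pdivrMr ?mul1r; last first.
  by rewrite ltr0n expn_gt0 (leq_trans _ (card_field_ge2 F)).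
rewrite ler_nat; apply: leq_trans (max_card _) _.
rewrite -cardsT -powersetT card_powerset cardsT card_prod !card_ord.
by case: (N * n)%N => // e; rewrite leq_exp2r // card_field_ge2.
Qed.

Lemma card_admissible_rank (d : nat) : (0 < d)%N ->
  #|[set w : 'M[L]_(K, N) * {ffun 'I_N -> 'M[F]_n} |
      [exists M : 'M[L]_(J, K), (\rank M == d) &&
        [exists W, admissible M W && ((kers phi M w.1 == W) &&
          [exists T, large T && vanishes phi M T w.1 w.2])]]]|%:R
    <= total * qR `^ ((n * (J * d + d * K) + J * J * N)%:R -
                      (rr + eps / 2) * d%:R * (N * n)%:R).
Proof.
move=> d_gt0; set y := (rr + eps / 2) * _ * _.
have bW (M : 'M[L]_(J, K)) : \rank M == d ->
  #|[set w : 'M[L]_(K, N) * {ffun 'I_N -> 'M[F]_n} |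
      [exists W, admissible M W && ((kers phi M w.1 == W) &&
          [exists T, large T && vanishes phi M T w.1 w.2])]]|%:R
    <= (q ^ (J * J * N))%:R * (total * qR `^ (- y)).
  move=> /eqP rM.
  apply: le_trans (card_exists_leq (x := total * qR `^ (- y)) _) _.
    by move=> W admW; rewrite /y -rM; apply: card_large_vanishing; rewrite ?rM.
  rewrite ler_wpM2r ?mulr_ge0 ?powR_ge0 // ler_nat.
  by apply: leq_trans (max_card _) _; rewrite card_ffun card_mx card_ord -expnM.
apply: le_trans (card_exists_leq bW) _.
rewrite powR_cardD powR_card_nat expnD natrM [leRHS]mulrCA -!mulrA.
rewrite [leRHS](_ : _ = (q ^ (n * (J * d + d * K)))%:R *
  ((q ^ (J * J * N))%:R * (total * qR `^ (- y)))); last by rewrite /y; ring.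
rewrite ler_wpM2r ?mulr_ge0 ?powR_ge0 // ler_nat expnM -(card_extension phiP).
by apply: leq_trans (card_mx_rank_leq L J K d); rewrite cardsE.
Qed.

Lemma card_admissible : K%:R = rr * N%:R -> (0 < n)%N ->
    8 * J%:R <= eps * N%:R -> 8 * (J * J)%:R <= eps * n%:R ->
  #|[set w : 'M[L]_(K, N) * {ffun 'I_N -> 'M[F]_n} |
      [exists M : 'M[L]_(J, K), [&& (0 < \rank M)%N, admissible M (kers phi M w.1) &
          [exists T, large T && vanishes phi M T w.1 w.2]]]]|%:R
    <= total * qR `^ (- (eps / 8 * n%:R * N%:R)).
Proof.
move=> KN n_gt0 JN JJn.
pose Q (d : 'I_J.+1) := [pred w : 'M[L]_(K, N) * {ffun 'I_N -> 'M[F]_n} |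
      [exists M : 'M[L]_(J, K), (\rank M == d) &&
        [exists W, admissible M W && ((kers phi M w.1 == W) &&
          [exists T, large T && vanishes phi M T w.1 w.2])]]].
apply: le_trans (_ : #|[set w | [exists d : 'I_J.+1, (0 < d)%N && Q d w]]|%:R <= _).
  rewrite ler_nat; apply/subset_leq_card/subsetP => w; rewrite !inE.
  move=> /existsP[M /and3P[rM admM vM]].
  have ltJ : (\rank M < J.+1)%N by rewrite ltnS rank_leq_row.
  apply/existsP; exists (Ordinal ltJ); rewrite rM /=.
  apply/existsP; exists M; rewrite eqxx /=.
  by apply/existsP; exists (kers phi M w.1); rewrite admM eqxx.
apply: le_trans (card_exists_leq (x := total * qR `^ (- (eps / 4 * n%:R * N%:R))) _) _.
  move=> d d_gt0; apply: le_trans (card_admissible_rank d_gt0) _.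
  rewrite ler_wpM2l // ler_powR ?card_field_ge1R //.
  have d_ge1 : (1 : R) <= d%:R by rewrite ler1n.
  rewrite !(natrD, natrM) KN.
  have nN_ge0 : 0 <= n%:R * N%:R :> R by rewrite mulr_ge0.
  have h1 : 8 * (n%:R * (J%:R * d%:R)) <= eps * (d%:R * (n%:R * N%:R)).
    by have := ler_wpM2r (mulr_ge0 (ler0n R n) (ler0n R d)) JN; lra.
  have h2 : 8 * (J%:R * J%:R * N%:R) <= eps * (n%:R * N%:R).
    by have := ler_wpM2r (ler0n R N) JJn; rewrite natrM; lra.
  have h3 : eps * (n%:R * N%:R) <= eps * (d%:R * (n%:R * N%:R)).
    by rewrite ler_wpM2l ?ler_peMl // ltW.
  lra.
rewrite mulrCA ler_wpM2l //.
rewrite (_ : - (eps / 4 * n%:R * N%:R) =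
  - (eps / 8 * n%:R * N%:R) + - (eps / 8 * n%:R * N%:R)); last by lra.
rewrite powR_cardD mulrA ler_piMl ?powR_ge0 // powRN ler_pdivrMr ?mul1r; last first.
  by apply: powR_gt0; apply: card_field_gt0R.
apply: le_trans (_ : (q ^ J)%:R <= _).
  rewrite ler_nat; apply: leq_trans (max_card _) _; rewrite card_ord.
  apply: leq_trans (_ : 2 ^ J <= _)%N; first exact: ltn_expl.
  by case: (J) => // j; rewrite leq_exp2r // card_field_ge2.
rewrite -powR_card_nat ler_powR ?card_field_ge1R //.
have n_ge1 : (1 : R) <= n%:R by rewrite ler1n.
have : N%:R <= n%:R * N%:R :> R by rewrite ler_peMl.
by move=> /(ler_wpM2l (ltW eps_gt0)); lra.
Qed.

End FixedDesign.

Lemma not_led_admissible (mu D K N : nat) (eps rr Lb : R) (Gout : 'M[L]_(K, N)) Gin :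
    (0 < mu)%N -> (0 < D)%N -> (q ^ (mu * D))%:R <= Lb ->
    ~~ led_list_decodable (concat_code phi Gout Gin) (1 - rr - eps) Lb ->
  [exists M : 'M[L]_(mu * D, K),
    [&& (0 < \rank M)%N, admissible mu D M (kers phi M Gout) &
      [exists T, large eps rr T && vanishes phi M T Gout Gin]]].
Proof.
move=> mu_gt0 D_gt0 qLb /forallPn[y]; rewrite negb_imply -ltNge => /andP[le_y lt_list].
pose T := [set p | y p != None].
have card_T : (#|T| + nerased y = N * n)%N.
  rewrite /nerased addnC (_ : T = ~: [set p | y p == None]); last first.
    by apply/setP => p; rewrite !inE.
  by rewrite cardsC card_prod !card_ord.
have largeT : large eps rr T.
  move: le_y; rewrite /large card_prod !card_ord -card_T natrD; lra.
have le_V : (q ^ (mu * D) <= #|[set m : 'rV[L]_K | vanishes phi m T Gout Gin]|)%N.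
  apply: leq_trans (card_agreeing_leq phiP Gout Gin y).
  by rewrite -(ler_nat R) ltW // (le_lt_trans qLb).
have [M [vM rM admM]] := exists_rows_vanishing phiP mu_gt0 D_gt0 le_V.
apply/existsP; exists M; apply/and3P; split=> //.
by apply/existsP; exists T; rewrite largeT.
Qed.

Lemma card_not_injective (K N : nat) :
  #|[set w : 'M[L]_(K, N) * {ffun 'I_N -> 'M[F]_n} |
      #|concat_code phi w.1 w.2| != (q ^ (n * K))%N]|%:R
  <= #|{: 'M[L]_(K, N) * {ffun 'I_N -> 'M[F]_n}}|%:R *
     qR `^ ((n * K)%:R + N%:R - (N * n)%:R).
Proof.
set total := #|{: _}|%:R.
pose Q (m : 'rV[L]_K) := [pred w : 'M[L]_(K, N) * {ffun 'I_N -> 'M[F]_n} |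
   [exists W : {ffun 'I_N -> 'M[F]_1}, true && ((kers phi m w.1 == W) &&
      vanishes phi m setT w.1 w.2)]].
apply: le_trans (_ : #|[set w | [exists m, (m != 0) && Q m w]]|%:R <= _).
  rewrite ler_nat; apply/subset_leq_card/subsetP => -[Gout Gin]; rewrite !inE /=.
  apply: contraNT => /existsPn inj_enc.
  rewrite concat_codeE card_imset ?card_mx ?mul1n ?(card_extension phiP) -?expnM //.
  move=> m m' eq_m; apply/eqP; rewrite -subr_eq0.
  apply: contraT => mm'; have := inj_enc (m - m'); rewrite mm' /=.
  case/existsP; exists (kers phi (m - m') Gout); rewrite eqxx /=.
  by apply/vanishes_encodeP => p _; rewrite (encodeB phiP) eq_m subrr.
have bm (m : 'rV[L]_K) : m != 0 -> #|[set w | Q m w]|%:R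
    <= (q ^ N)%:R * (total * qR `^ (- (N * n)%:R)).
  move=> m_neq0.
  apply: le_trans (card_exists_leq (x := total * qR `^ (- (N * n)%:R)) _) _.
    move=> W _; apply: natr_le_powRN (card_fixed_kers phiP m W setT) _.
    rewrite ler_nat; apply: leq_trans (kers_exponent_ge_rank _ _ _ _).
    by rewrite cardsT card_prod !card_ord rank_rV m_neq0 mul1n.
  rewrite ler_wpM2r ?mulr_ge0 ?powR_ge0 // ler_nat.
  by apply: leq_trans (max_card _) _; rewrite card_ffun card_mx card_ord.
apply: le_trans (card_exists_leq bm) _.
rewrite !powR_cardD !powR_card_nat.
rewrite [leRHS](_ : _ = (q ^ (n * K))%:R *
  ((q ^ N)%:R * (total * qR `^ (- (N * n)%:R)))); last by ring.
rewrite ler_wpM2r ?mulr_ge0 ?powR_ge0 // ler_nat expnM -(card_extension phiP).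
by apply: leq_trans (max_card _) _; rewrite card_mx mul1n.
Qed.

End UnionBound.

Lemma ratr_natM (R : realType) (r : rat) (N K : nat) :
  (K%:R : rat) = r * N%:R -> (K%:R : R) = ratr r * N%:R.
Proof. by move=> KN; rewrite -(ratr_nat R K) KN rmorphM /= ratr_nat. Qed.

Theorem theorem4p5 (R : realType) :
  exists C0 : R, 0 < C0 /\
  forall (F : finFieldType) (r : rat), 0 < r -> r <= 1 ->
  (* list-decodability claim *)
  (forall eps : R, 0 < eps ->
     exists c : R, 0 < c /\ exists n0 : nat,
     forall n N K : nat, (n0 <= n)%N -> (n0 <= N)%N -> (n0 <= K)%N ->
     (K%:R : rat) = r * N%:R ->
     forall (L : finFieldType) (iota : {rmorphism F -> L}) (phi : L -> 'rV[F]_n),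
     linear_identification iota phi ->
     prob_choice R (fun (Gout : 'M[L]_(K, N)) (Gin : {ffun 'I_N -> 'M[F]_n}) =>
        led_list_decodable (concat_code phi Gout Gin)
          (1 - ratr r - eps) ((#|F|)%:R `^ (C0 / eps ^+ 2)))
     >= 1 - (#|F|)%:R `^ (- (c * n%:R * N%:R))) /\
  (* rate claim (see NOTES.md, FIDELITY: needs r < 1) *)
  (r < 1 ->
   forall delta : R, 0 < delta -> exists n1 : nat,
     forall n N K : nat, (n1 <= n)%N -> (n1 <= N)%N -> (n1 <= K)%N ->
     (K%:R : rat) = r * N%:R ->
     forall (L : finFieldType) (iota : {rmorphism F -> L}) (phi : L -> 'rV[F]_n),
     linear_identification iota phi ->
     prob_choice R (fun (Gout : 'M[L]_(K, N)) (Gin : {ffun 'I_N -> 'M[F]_n}) =>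
        #|concat_code phi Gout Gin| == (#|F| ^ (n * K))%N) >= 1 - delta).
Proof.
exists 18; split=> // F r r_gt0 r_le1.
have rr_gt0 : 0 < (ratr r : R) by rewrite ltr0q.
have rr_le1 : (ratr r : R) <= 1 by have := r_le1; rewrite -(ler_rat R) rmorph1.
split=> [eps eps_gt0|r_lt1 delta delta_gt0].
- have [eps_le1|eps_gt1] := leP eps 1; last first.
    exists 1; split=> //; exists 1%N => n N K n_gt0 N_gt0 _ KN L iota phi phiP.
    apply: prob_choice_ge; rewrite (_ : [set _ | _] = set0).
      by rewrite cards0 mulr_ge0 ?powR_ge0.
    apply/setP => w; rewrite !inE; apply/negbTE; rewrite negbK.
    apply/forallP => y; apply/implyP => le_y; exfalso.
    have : 0 <= (1 - ratr r - eps) * #|{: 'I_N * 'I_n}|%:R :> R.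
      by apply: le_trans le_y.
    rewrite pmulr_lge0 ?card_prod ?card_ord ?ltr0n ?muln_gt0 ?n_gt0 ?N_gt0 //.
    lra.
  pose mu := (Num.truncn (5 / eps)).+1; pose D := (Num.truncn (2 / eps)).+1.
  pose J := (mu * D)%N.
  have mu_ge : 5 <= eps * mu%:R.
    by rewrite mulrC -ler_pdivrMr // ltW // truncnS_gt.
  have D_ge : 2 <= eps * D%:R.
    by rewrite mulrC -ler_pdivrMr // ltW // truncnS_gt.
  have mu_le : mu%:R <= 6 / eps.
    have : (Num.truncn (5 / eps))%:R <= 5 / eps by rewrite truncn_le divr_ge0 // ltW.
    have : 1 <= 1 / eps by rewrite ler_pdivlMr ?mul1r.
    by rewrite -[mu%:R]natr1; lra.
  have D_le : D%:R <= 3 / eps.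
    have : (Num.truncn (2 / eps))%:R <= 2 / eps by rewrite truncn_le divr_ge0 // ltW.
    have : 1 <= 1 / eps by rewrite ler_pdivlMr ?mul1r.
    by rewrite -[D%:R]natr1; lra.
  have J_le : J%:R <= 18 / eps ^+ 2.
    rewrite /J natrM (_ : 18 / eps ^+ 2 = 6 / eps * (3 / eps)).
      by apply: ler_pM.
    by field; rewrite gt_eqF.
  have J_gt0 : (0 < J)%N by [].
  exists (eps / 8); split; first by rewrite divr_gt0.
  pose n0 := (Num.truncn (8 * (J * J)%:R / eps)).+1.
  exists n0 => n N K le_n le_N _ KN L iota phi phiP.
  have n0P (m : nat) : (n0 <= m)%N -> 8 * (J * J)%:R <= eps * m%:R.
    move=> le_m; rewrite mulrC [leRHS]mulrC -ler_pdivrMr //.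
    apply: le_trans (ltW (truncnS_gt _)) _; rewrite ler_nat mulrC.
    exact: le_m.
  have JN : 8 * J%:R <= eps * N%:R.
    apply: le_trans (n0P _ le_N); rewrite ler_wpM2l // ler_nat.
    by rewrite leq_pmulr.
  apply: prob_choice_ge.
  have n_gt0 : (0 < n)%N by apply: leq_ltn_trans le_n.
  have KNR := ratr_natM R KN.
  have := card_admissible phiP eps_gt0 eps_le1 rr_le1 mu_ge D_ge KNR n_gt0 JN (n0P _ le_n).
  apply: le_trans; rewrite ler_nat; apply/subset_leq_card/subsetP => w; rewrite !inE.
  apply: (not_led_admissible phiP) => //.
  by rewrite -powR_card_nat ler_powR // card_field_ge1R.
have rr_lt1 : (ratr r : R) < 1 by have := r_lt1; rewrite -(ltr_rat R) rmorph1.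
pose a := 2 / (1 - ratr r : R); pose n1 := maxn (Num.truncn a).+1 (Num.truncn delta^-1).+1.
exists n1 => n N K le_n le_N _ KN L iota phi phiP.
apply: prob_choice_ge.
apply: le_trans (card_not_injective phiP R K N) _.
rewrite ler_wpM2l // !natrM (ratr_natM R KN).
have n_ge : 2 <= n%:R * (1 - ratr r : R).
  rewrite -ler_pdivrMr ?subr_gt0 //; apply: le_trans (ltW (truncnS_gt _)) _.
  by rewrite ler_nat; apply: leq_trans le_n; apply: leq_maxl.
have N_ge : delta^-1 <= N%:R.
  apply: le_trans (ltW (truncnS_gt _)) _.
  by rewrite ler_nat; apply: leq_trans le_N; apply: leq_maxr.
apply: le_trans (_ : #|F|%:R `^ (- N%:R) <= _).
  rewrite ler_powR ?card_field_ge1R //.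
  by have := ler_wpM2r (ler0n R N) n_ge; lra.
rewrite powRN powR_card_nat invf_ple ?posrE //; last first.
  by rewrite ltr0n expn_gt0 (leq_trans _ (card_field_ge2 F)).
apply: le_trans N_ge _; rewrite ler_nat.
exact/ltnW/ltn_expl/card_field_ge2.
Qed.
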